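(* For any decision points $(d_1,d_2,d_3)\in(0,1)^3$, the triangle process has at most four periodic orbits.
   Context: Triangle process. Fix $\lambda_1,\lambda_2,\lambda_3>0$, $\mu_1,\mu_2,\mu_3>0$ with $\rho_i:=\lambda_i/\mu_i<1$ for each $i$ and $\rho_1+\rho_2+\rho_3>1$. Put $\theta_j:=\mu_j^{-1}(\lambda_1+\lambda_2+\lambda_3)-1$. Let $e_1,e_2,e_3$ be the standard basis of $\mathbb R^3$, $A_i^0:=\{y\in\mathbb R^3: y_1+y_2+y_3=1,\ y_i=0,\ y_l\ge0\ \forall l\}$ and $A^0:=A_1^0\cup A_2^0\cup A_3^0$. For $j\in\{1,2,3\}$ and $z\in A^0\setminus A_j^0$ let $f_j(z):=\sum_{i\neq j}\frac{(\mu_j-\lambda_j)z_i+\lambda_i z_j}{(\mu_j-\lambda_j)+\mu_j\theta_j z_j}\,e_i\in A_j^0$. Let $(\hat i,\hat j,\hat k)$ denote $(1,2,3)$ or one of its cyclic permutations; the point $(1-x)e_{\hat j}+xe_{\hat k}\in A^0_{\hat i}$, $x\in[0,1]$, is written $(x,\hat i)$. Decision points are numbers $d_1,d_2,d_3\in(0,1)$, identified with the points $(d_{\hat i},\hat i)$. The switching rule is $\mathfrak R((x,\hat i))=\hat j$ if $x<d_{\hat i}$, $=\hat k$ if $x>d_{\hat i}$, and both values are allowed if $x=d_{\hat i}$. The (possibly two-valued) map is $\varphi(z):=f_{\mathfrak R(z)}(z)$. A periodic orbit is a finite sequence $u_1,\dots,u_m$ of points of $A^0$ with $u_{n+1}\in\varphi(u_n)$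 for $n<m$ and $u_1\in\varphi(u_m)$; orbits differing by a cyclic shift are identified.
   Formalization: A periodic orbit is taken to consist of pairwise distinct points; otherwise running through the same orbit several times would count as infinitely many different orbits. *)

(* Defs.v *)
(* R : realType, points of R^3 as 'rV[R]_3, indices 'I_3
   (index 0,1,2 of 'I_3 corresponds to 1,2,3 in the paper). *)
From HB Require Import structures.
From mathcomp Require Import all_boot all_order all_algebra.
From mathcomp Require Import reals.
Set Implicit Arguments. Unset Strict Implicit. Unset Printing Implicit Defensive.
Import Order.TTheory GRing.Theory Num.Theory.
Local Open Scope ring_scope.

Section Triangle.
Variable R : realType.
Variables lam mu : 'I_3 -> R.
Variable d : 'I_3 -> R.

Definition coord (y : 'rV[R]_3) (l : 'I_3) : R := y ord0 l.

Definition theta (j : 'I_3) : R := (mu j)^-1 * (\sum_(i < 3) lam i) - 1.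

Definition inA (i : 'I_3) (y : 'rV[R]_3) : bool :=
  [&& \sum_(l < 3) coord y l == 1, coord y i == 0 & [forall l, 0 <= coord y l]].

Definition inA0 (y : 'rV[R]_3) : bool := [exists i, inA i y].

Definition f (j : 'I_3) (z : 'rV[R]_3) : 'rV[R]_3 :=
  \row_(i < 3) (if i == j then 0 else
     ((mu j - lam j) * coord z i + lam i * coord z j)
       / ((mu j - lam j) + mu j * theta j * coord z j)).

(* (hat i, hat j, hat k) cyclic: hat j = i+1, hat k = i+2 (mod 3).
   A point z of A_i^0 is (x, i) with z = (1-x) e_j + x e_k, i.e. x = z_k.
   Rule: x < d_i -> j ; x > d_i -> k ; x = d_i -> both.
   step u v  <=>  v \in phi(u). *)
Definition step (u v : 'rV[R]_3) : bool :=
  [exists i : 'I_3,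
    inA i u &&
    (((coord u (ordS (ordS i)) <= d i) && (v == f (ordS i) u))
     || ((d i <= coord u (ordS (ordS i))) && (v == f (ordS (ordS i)) u)))].

Definition periodic_orbit (s : seq 'rV[R]_3) : bool :=
  [&& s != [::], uniq s, all inA0 s & cycle step s].

End Triangle.

(* Main.v *)
(* Each f_j is the restriction of a projective map sending either edge adjacent
   to e_j into a proper subsegment of the opposite edge, so it strictly contracts
   the Hilbert metric of the edges.  Moreover every point has at most one
   phi-preimage, so distinct periodic orbits are disjoint and phi permutes the
   finite set P of their points.

   Let h be a phi-invariant labelling of P taking equal values at the two points
   of P adjacent to d_i, for each i.  Among the pairs on a common edge with
   different labels take one at minimal distance.  It cannot lie on one side of
   the decision point, since its image would be closer; and if it straddles d_i,
   one of its points and its neighbour at d_i form such a one-sided pair.  Hence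
   h is constant on edges, and then on P because a point and its image lie on
   different edges.  The three equalities imposed on h merge at most three pairs
   of orbits, so five orbits would admit a non-constant h. *)
Require Import Defs.
From HB Require Import structures.
From mathcomp Require Import all_boot all_order all_algebra.
From mathcomp Require Import reals.
From mathcomp Require Import boolp ring lra zify.
Import Order.TTheory GRing.Theory Num.Theory.
Local Open Scope ring_scope.
Set Implicit Arguments.
Unset Strict Implicit.
Unset Printing Implicit Defensive.

(** * Finite sequences: minima, merging of values, cycles with unique predecessors *)

Lemma seq_argmin (T : eqType) (R : realDomainType) (F : T -> R) (s : seq T) x0 :
  x0 \in s -> exists2 m, m \in s & {in s, forall y, F m <= F y}.
Proof.
elim: s x0 => // a s IHs x0 _.
case: s IHs => [_|b s /(_ b (mem_head _ _)) [m ms min_m]].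
  by exists a; rewrite ?mem_head // => y; rewrite inE => /eqP->.
case: (leP (F a) (F m)) => [le_am|lt_ma].
  exists a; rewrite ?mem_head // => y; rewrite inE => /predU1P[->//|/min_m].
  exact: le_trans.
exists m; first by rewrite inE ms orbT.
by move=> y; rewrite inE => /predU1P[->|/min_m//]; apply: ltW.
Qed.

(** Every value other than [a] is fixed by the merge and therefore survives. *)
Lemma size_undup_merge (T : eqType) (a b : T) (s : seq T) :
  ((size (undup s)).-1 <=
     size (undup [seq if y == a then b else y | y <- s]))%N.
Proof.
apply: (@leq_trans (size (rem a (undup s)))).
  have [/size_rem->//|/rem_id->] := boolP (a \in undup s).
  exact: leq_pred.
apply: uniq_leq_size; first exact/rem_uniq/undup_uniq.
move=> y; rewrite mem_rem_uniq ?undup_uniq // !inE !mem_undup => /andP[ya ys].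
by apply/mapP; exists y; rewrite // (negPf ya).
Qed.

Lemma ord3_cases (i : 'I_3) : [\/ i = ord0, i = ordS ord0 | i = ordS (ordS ord0)].
Proof.
by case: i => [[|[|[|//]]] ?];
  [constructor 1 | constructor 2 | constructor 3]; apply: val_inj.
Qed.

(** [g] is built by three successive merges, each losing at most one value, so at least two of the
    five or more initial values remain. *)
Lemma merge_three (T : eqType) (a b : 'I_3 -> T) (s : seq T) :
  uniq s -> (4 < size s)%N ->
  exists g : T -> T, (forall i, g (a i) = g (b i)) /\
    exists2 p, p \in s & exists2 q, q \in s & g p != g q.
Proof.
move=> s_uniq s_gt4.
pose mg (g : T -> T) i y := if g y == g (a i) then g (b i) else g y.
have mgE g i : mg g i (a i) = mg g i (b i).
  by rewrite /mg eqxx; case: ifP.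
have mg_eq g i u v : g u = g v -> mg g i u = mg g i v by rewrite /mg => ->.
have mg_size g i : ((size (undup (map g s))).-1 <= size (undup (map (mg g i) s)))%N.
  have := size_undup_merge (g (a i)) (g (b i)) (map g s).
  by rewrite -map_comp.
pose g0 := mg id ord0; pose g1 := mg g0 (ordS ord0).
pose g := mg g1 (ordS (ordS ord0)).
exists g; split.
  (* Each stage is a function of the previous one, so an equality once achieved persists. *)
  have gE u v : g0 u = g0 v -> g u = g v by move=> e; apply/mg_eq/mg_eq.
  have gE' u v : g1 u = g1 v -> g u = g v by move=> e; apply: mg_eq.
  move=> i; have [->|->|->] := ord3_cases i.
  - exact/gE/mgE.
  - exact/gE'/mgE.
  - exact: mgE.
have : (1 < size (undup (map g s)))%N.
  have h0 := mg_size id ord0; rewrite map_id undup_id // in h0.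
  have h1 := mg_size g0 (ordS ord0); have h2 := mg_size g1 (ordS (ordS ord0)).
  rewrite -/g0 -/g1 -/g in h0 h1 h2.
  by move: s_gt4 h0 h1 h2; clear; lia.
have uU := undup_uniq (map g s).
case defU : (undup (map g s)) uU => [|y [|z U]] //=.
rewrite inE negb_or -andbA => /andP[yz _] _.
have memU w : w \in [:: y, z & U] -> exists2 p, p \in s & w = g p.
  by rewrite -defU mem_undup => /mapP.
have [p ps yE] := memU y (mem_head _ _).
have [|q qs zE] := memU z; first by rewrite !inE eqxx orbT.
by exists p => //; exists q => //; rewrite -yE -zE.
Qed.

(** Read backwards from the common endpoint [y], both paths are forced; as [x] occurs in neither [p]
    nor [q], they reach [x] after equally many steps. *)
Lemma path_pred_inj (T : eqType) (e : rel T) :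
  (forall x y z, e x z -> e y z -> x = y) ->
  forall (x y : T) p q, path e x (rcons p y) -> path e x (rcons q y) ->
  x \notin p -> x \notin q -> p = q.
Proof.
move=> e_inj x y p; elim/last_ind: p y => [|p a IHp] y q.
  case/lastP: q => // q b; rewrite !rcons_path /= => exy /andP[_].
  by rewrite last_rcons => /(e_inj _ _ _ exy) <- _; rewrite mem_rcons mem_head.
case/lastP: q => [|q b]; rewrite (rcons_path e x (rcons p a) y) last_rcons.
  by move=> /andP[_ eay]; rewrite /= andbT => exy; rewrite (e_inj _ _ _ exy eay) mem_rcons mem_head.
rewrite (rcons_path e x (rcons q b) y) last_rcons.
move=> /andP[pp eay] /andP[pq eby]; rewrite -(e_inj _ _ _ eay eby) in pq *.
rewrite !mem_rcons !inE !negb_or => /andP[_ xp] /andP[_ xq].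
by rewrite (IHp a q).
Qed.

Lemma cycles_meet_rot (T : eqType) (e : rel T) (s t : seq T) x :
  (forall x y z, e x z -> e y z -> x = y) ->
  uniq s -> uniq t -> cycle e s -> cycle e t ->
  x \in s -> x \in t -> exists n, s = rot n t.
Proof.
move=> e_inj us ut cs ct /rot_to[i p defs] /rot_to[j q deft].
have := us; have := ut; have := cs; have := ct.
rewrite -(rot_cycle i e s) -(rot_cycle j e t) -(rot_uniq i s) -(rot_uniq j t).
rewrite defs deft /= => cq cp /andP[xq _] /andP[xp _].
have pq := path_pred_inj e_inj cp cq xp xq.
exists (rot_add t j (size (rot i s) - i)).
by rewrite -rot_rot_add deft -pq -defs; apply/esym/rotK.
Qed.

(** * Combinatorics of the three indices *)

(** The value of the switching rule on edge [e]: [true] stands for the side below the decision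
    point, [false] for the side above. *)
Definition target (e : 'I_3) (b : bool) := if b then ordS e else ordS (ordS e).

Lemma target_neq e b : target e b != e.
Proof. by case: b e => -[[|[|[|]]]]. Qed.

Lemma ord3_third (l e : 'I_3) : e != l -> exists e', [/\ e' != l, e' != e &
   forall x, [\/ x = l, x = e | x = e']].
Proof.
(* The three indices add up to 3, whence the witness [3 - i - j]. *)
have third (i j : 'I_3) : i != j -> [exists k, [&& k != i, k != j &
    [forall x, [|| x == i, x == j | x == k]]]].
  move=> ij; apply/existsP; exists (inord (3 - i - j)); move: ij.
  case: i j => [[|[|[|//]]] i3] [[|[|[|//]]] j3]; rewrite -!val_eqE //= => _;
  rewrite ?inordK //; apply/forallP=> -[[|[|[|//]]] x3];
  by rewrite -!val_eqE /= ?inordK.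
rewrite eq_sym => /third/existsP[k /and3P[kl ke /forallP all_k]].
by exists k; split=> // x; have /or3P[] := all_k x => /eqP->; constructor.
Qed.

(** * Hilbert metric of an edge and the projective maps in one coordinate *)

Section Hilbert.
Variable R : realFieldType.
Implicit Types x y z t a b g : R.

(* With r = x / (1 - x), s = y / (1 - y) this is r / s + s / r - 2, a function of
   the Hilbert distance |ln (r / s)|. *)
Definition hdist x y := (y - x) ^+ 2 / (x * (1 - x) * (y * (1 - y))).

Lemma hdistC x y : hdist x y = hdist y x.
Proof. by rewrite /hdist [_ * (y * _)]mulrC -sqrrN opprB. Qed.

Lemma hdist_compl x y : hdist (1 - x) (1 - y) = hdist x y.
Proof.
rewrite /hdist; congr (_ / _); last by ring.
by ring.
Qed.

Lemma hdist_monor x z y : 0 < x -> y < 1 -> x <= z <= y -> hdist x z <= hdist x y.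
Proof.
move=> x0 y1 /andP[xz zy].
have z0 : 0 < z := lt_le_trans x0 xz; have z1 : z < 1 := le_lt_trans zy y1.
have y0 : 0 < y := lt_le_trans z0 zy; have x1 : x < 1 := le_lt_trans xz z1.
have split_div a b c : a / (b * c) = b^-1 * (a / c) by rewrite invfM mulrCA.
rewrite /hdist !(split_div _ (x * (1 - x))).
rewrite ler_pM2l ?invr_gt0 ?mulr_gt0 ?subr_gt0 //.
rewrite ler_pdivrMr ?mulr_gt0 ?subr_gt0 // mulrAC ler_pdivlMr ?mulr_gt0 ?subr_gt0 //.
(* The product of [h1] and [h2] is the goal with denominators cleared. *)
have h1 : (z - x) * y <= (y - x) * z by nra.
have h2 : (z - x) * (1 - y) <= (y - x) * (1 - z) by nra.
have h3 : 0 <= (z - x) * y by rewrite mulr_ge0 ?subr_ge0 // ltW.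
have h4 : 0 <= (z - x) * (1 - y) by rewrite mulr_ge0 ?subr_ge0 // ltW.
by have := ler_pM h3 h4 h1 h2; lra.
Qed.

Lemma hdist_monol x z y : 0 < x -> y < 1 -> x <= z <= y -> hdist z y <= hdist x y.
Proof.
move=> x0 y1 /andP[xz zy].
rewrite -[hdist z y]hdist_compl -[hdist x y]hdist_compl hdistC [X in _ <= X]hdistC.
by apply: hdist_monor; lra.
Qed.

(* The coordinate of f_l z along e when z lies on the edge z_e = 0, in terms of
   t = z_l, with a = lam_e, b the third rate and g = mu_l - lam_l. *)
Definition pushed a b g t := a * t / (g * (1 - t) + (a + b) * t).

Lemma pushed_den_gt0 a b g t : 0 < a -> 0 < b -> 0 < g -> 0 < t -> t <= 1 ->
  0 < g * (1 - t) + (a + b) * t.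
Proof.
move=> a0 b0 g0 t0 t1; apply: ltr_wpDl; first by rewrite mulr_ge0 ?subr_ge0 // ltW.
by rewrite mulr_gt0 ?addr_gt0.
Qed.

(** Up to the factor [a], the odds of the image are [t / (g * (1 - t) + b * t)]. The two sides thus
    differ only in that each [g * (1 - t)] is replaced by the larger [g * (1 - t) + b * t];
    strictness comes from [b > 0]. *)
Lemma hdist_pushed a b g x y : 0 < a -> 0 < b -> 0 < g ->
  0 < x < 1 -> 0 < y < 1 -> x != y ->
  hdist (pushed a b g x) (pushed a b g y) < hdist x y.
Proof.
move=> a0 b0 g0 /andP[x0 x1] /andP[y0 y1] xy.
have dx := pushed_den_gt0 a0 b0 g0 x0 (ltW x1).
have dy := pushed_den_gt0 a0 b0 g0 y0 (ltW y1).
have sx : 0 < 1 - x by rewrite subr_gt0.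
have sy : 0 < 1 - y by rewrite subr_gt0.
have gx : 0 < g * (1 - x) by rewrite mulr_gt0.
have gy : 0 < g * (1 - y) by rewrite mulr_gt0.
have bx : 0 < b * x by rewrite mulr_gt0.
have by' : 0 < b * y by rewrite mulr_gt0.
have ex : 0 < g * (1 - x) + b * x by lra.
have ey : 0 < g * (1 - y) + b * y by lra.
have -> : hdist (pushed a b g x) (pushed a b g y) =
   (y - x) ^+ 2 * (g ^+ 2 / (x * y * ((g * (1 - x) + b * x) * (g * (1 - y) + b * y)))).
  rewrite /hdist /pushed; field.
  by rewrite ?(gt_eqF a0) ?(gt_eqF b0) ?(gt_eqF x0) ?(gt_eqF y0) ?(gt_eqF dx) ?(gt_eqF dy)
     ?(gt_eqF ex) ?(gt_eqF ey).
rewrite /hdist ltr_pM2l; last by rewrite exprn_even_gt0 //= subr_eq0 eq_sym.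
rewrite -(@ltf_pV2 R) ?posrE ?invr_gt0 ?divr_gt0 ?mulr_gt0 ?exprn_gt0 // invrK.
rewrite invf_div ltr_pdivlMr ?exprn_gt0 //.
have -> : x * (1 - x) * (y * (1 - y)) * g ^+ 2 = x * y * ((g * (1 - x)) * (g * (1 - y))) by ring.
rewrite ltr_pM2l ?mulr_gt0 //.
by apply: ltr_pM; rewrite ?ltW // ltrDl.
Qed.

Lemma pushed_inj a b g x y : 0 < a -> 0 < b -> 0 < g ->
  0 < x <= 1 -> 0 < y <= 1 -> pushed a b g x = pushed a b g y -> x = y.
Proof.
move=> a0 b0 g0 /andP[x0 x1] /andP[y0 y1] /eqP.
have dx := pushed_den_gt0 a0 b0 g0 x0 x1.
have dy := pushed_den_gt0 a0 b0 g0 y0 y1.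
rewrite /pushed eqr_div ?(gt_eqF dx) ?(gt_eqF dy) // -subr_eq0.
have -> : a * x * (g * (1 - y) + (a + b) * y) - a * y * (g * (1 - x) + (a + b) * x)
  = a * g * (x - y) by ring.
by rewrite !mulf_eq0 (gt_eqF a0) (gt_eqF g0) /= subr_eq0 => /eqP.
Qed.

(** The two summands are at most [a / (a + b)] and [b / (a + b)], with equality only at 1, and these
    bounds add up to 1. Geometrically, the images of the two edges adjacent to a vertex share only
    the image of that vertex. *)
Lemma pushed_sum a b g x y : 0 < a -> 0 < b -> 0 < g ->
  0 < x <= 1 -> 0 < y <= 1 -> pushed a b g x + pushed b a g y = 1 -> x = 1 /\ y = 1.
Proof.
move=> a0 b0 g0 /andP[x0 x1] /andP[y0 y1].
have bnd c e t : 0 < c -> 0 < e -> 0 < t -> t <= 1 ->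
    pushed c e g t <= c / (c + e) ?= iff (t == 1).
  move=> c0 e0 t0 t1; have dt := pushed_den_gt0 c0 e0 g0 t0 t1.
  have ce : 0 < c + e by rewrite addr_gt0.
  apply/leifP; case: eqVneq => [->|t'].
    by rewrite /pushed subrr mulr0 add0r !mulr1.
  have t2 : t < 1 by rewrite lt_neqAle t' t1.
  rewrite /pushed ltr_pdivrMr // mulrAC ltr_pdivlMr // -!mulrA ltr_pM2l //.
  by rewrite mulrC ltrDr mulr_gt0 // subr_gt0.
have := leifD (bnd a b x a0 b0 x0 x1) (bnd b a y b0 a0 y0 y1).
rewrite [b + a]addrC -mulrDl divff ?(gt_eqF (addr_gt0 a0 b0)) // => -[_ /[swap] ->].
by rewrite eqxx => /esym/andP[/eqP-> /eqP->].
Qed.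
End Hilbert.

(** * Invariant labellings of a finite set under a piecewise contraction, abstractly *)

Section Invariant.
Variables (X : eqType) (R : realDomainType) (P : seq X).
Variables (edge : X -> 'I_3) (side : X -> bool) (x : X -> R) (E : X -> X -> R).
Variable nxt : X -> X.
Hypothesis nxtP : {in P, forall u, nxt u \in P}.
Hypothesis nxt_surj : {in P, forall v, exists2 u, u \in P & nxt u = v}.
Hypothesis edge_nxt : {in P, forall u, edge (nxt u) = target (edge u) (side u)}.
Hypothesis E_sym : forall u v, E u v = E v u.
Hypothesis E_contr : {in P &, forall u v, u != v -> edge u = edge v ->
  side u = side v -> E (nxt u) (nxt v) < E u v}.
Hypothesis side_le : {in P &, forall u v, edge u = edge v ->
  side u -> ~~ side v -> x u <= x v}.
Hypothesis E_mono : {in P & &, forall u w v, edge u = edge w -> edge w = edge v ->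
  x u <= x w <= x v -> E u w <= E u v /\ E w v <= E u v}.
(* [top i] and [bot i] are the points of P next to the decision point of edge i;
   their values are irrelevant when that side carries no point of P. *)
Variables (Y : eqType) (h : X -> Y) (top bot : 'I_3 -> X).
Hypothesis h_nxt : {in P, forall u, h (nxt u) = h u}.
Hypothesis topP : {in P, forall u, side u -> let t := top (edge u) in
  [/\ t \in P, edge t = edge u, side t & x u <= x t]}.
Hypothesis botP : {in P, forall u, ~~ side u -> let t := bot (edge u) in
  [/\ t \in P, edge t = edge u, ~~ side t & x t <= x u]}.
Hypothesis h_straddle : forall i, h (top i) = h (bot i).

Lemma invariant_const_edge : {in P &, forall u v, edge u = edge v -> h u = h v}.
Proof.
move=> u0 v0 Pu0 Pv0 e0; apply/eqP/negPn/negP => h0.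
pose bad := [seq p <- allpairs pair P P | (edge p.1 == edge p.2) && (h p.1 != h p.2)].
have badP p : p \in bad <-> [/\ p.1 \in P, p.2 \in P, edge p.1 = edge p.2 & h p.1 != h p.2].
  rewrite mem_filter; split.
    by case/andP=> /andP[/eqP e1 h1] /allpairsP[[a b] /= [Pa Pb pE]]; move: e1 h1; rewrite pE.
  by case: p => a b [/= Pa Pb -> ->]; rewrite eqxx; apply/allpairsP; exists (a, b).
have bad0 : (u0, v0) \in bad by apply/badP.
have [[u v] /badP[/= Pu Pv euv huv] minE] := seq_argmin (fun p => E p.1 p.2) bad0.
have same_side a b : a \in P -> b \in P -> edge a = edge b -> side a = side b ->
    E a b <= E u v -> h a = h b.
  move=> Pa Pb eab sab Eab; apply/eqP/negPn/negP => hab.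
  have ab : a != b by apply: contraNneq hab => ->.
  have /(lt_le_trans (E_contr Pa Pb ab eab sab)) := Eab.
  rewrite ltNge => /negP; apply.
  by apply: (minE (nxt a, nxt b)); apply/badP; rewrite /= !nxtP // !edge_nxt // eab sab !h_nxt.
have straddle a b : a \in P -> b \in P -> edge a = edge b -> side a -> ~~ side b ->
    E a b <= E u v -> h a = h b.
  move=> Pa Pb eab sa sb Eab.
  have [/= Pt et st xt] := topP Pa sa; have [/= Pc ec sc xc] := botP Pb sb.
  rewrite -eab in ec Pc sc xc.
  (* In position, [a], its [top], its [bot] and [b] come in this order, so both one-sided end pairs
     are no farther apart than [a] and [b]; [h_straddle] bridges the middle. *)
  have xtc := side_le Pt Pc (etrans et (esym ec)) st sc.
  have [Eat _] := E_mono Pa Pt Pb (esym et) (etrans et eab) (introT andP (conj xt (le_trans xtc xc))).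
  have [_ Ecb] := E_mono Pa Pc Pb (esym ec) (etrans ec eab) (introT andP (conj (le_trans xt xtc) xc)).
  rewrite (same_side _ _ Pa Pt) ?et ?sa ?st ?(le_trans Eat) // h_straddle.
  by apply: same_side => //; rewrite ?ec // ?(negPf sc) ?(negPf sb) // (le_trans Ecb).
case su: (side u) (boolP (side v)) => [] [sv|sv]; move/eqP: huv; apply.
- by apply: same_side; rewrite // su sv.
- exact: straddle.
- by apply/esym/straddle; rewrite // ?su // E_sym.
- by apply: same_side; rewrite // su (negPf sv).
Qed.

(** Points on different edges are compared through predecessors, which lie on other edges and carry
    the same labels. If neither predecessor lies on the edge of the other point, both lie on the
    third edge. *)
Lemma invariant_const : {in P &, forall u v, h u = h v}.
Proof.
move=> u v Pu Pv.
have [/invariant_const_edge|euv] := eqVneq (edge u) (edge v); first exact.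
have pred w : w \in P -> exists p, [/\ p \in P, h p = h w & edge p != edge w].
  move=> /nxt_surj[p Pp <-]; exists p; split=> //; first by rewrite h_nxt.
  by rewrite edge_nxt // eq_sym target_neq.
have [p [Pp hp ep]] := pred u Pu; have [q [Pq hq eq]] := pred v Pv.
have [k [_ _ all_k]] := ord3_third euv.
rewrite -hp -hq; have [ep'|ep'|ep'] := all_k (edge p).
- by rewrite hq; apply: invariant_const_edge.
- by rewrite ep' eqxx in ep.
have [eq'|eq'|eq'] := all_k (edge q).
- by rewrite eq' eqxx in eq.
- by rewrite hp; apply/invariant_const_edge.
- by apply: invariant_const_edge; rewrite // ep'.
Qed.
End Invariant.

Lemma ord3_sum (V : nmodType) (F : 'I_3 -> V) (l e e' : 'I_3) :
  e != l -> e' != l -> e' != e -> \sum_i F i = F l + (F e + F e').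
Proof.
move=> el e'l e'e; rewrite (bigD1 l) // (bigD1 e) //= (big_pred1 e') // => i /=.
have [k [kl ke all_k]] := ord3_third el.
have -> : e' = k by case: (all_k e') e'l e'e => ->; rewrite ?eqxx.
by case: (all_k i) => ->; rewrite ?eqxx ?andbF /= ?kl ?ke // 1?[in RHS]eq_sym ?(negPf kl) ?(negPf ke).
Qed.

(* [coord] alone is now that of mathcomp's vector library. *)
Local Notation coord := Defs.coord.

(** * The triangle process: images, unique predecessors, contraction *)

Section Process.
Variables (R : realType) (lam mu d : 'I_3 -> R).
Hypothesis lam_gt0 : forall i, 0 < lam i.
Hypothesis mu_gt0 : forall i, 0 < mu i.
Hypothesis rho_lt1 : forall i, lam i / mu i < 1.
Hypothesis d01 : forall i, 0 < d i < 1.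
Implicit Types (u v w : 'rV[R]_3) (e l : 'I_3).

Lemma inAP e u : inA e u ->
  [/\ \sum_l coord u l = 1, coord u e = 0 & forall l, 0 <= coord u l].
Proof. by case/and3P=> /eqP ? /eqP ? /forallP. Qed.

Lemma inA_compl e u l e' : inA e u -> l != e -> e' != e -> e' != l ->
  coord u e' = 1 - coord u l.
Proof.
move=> /inAP[u1 ue _] le e'e e'l.
by rewrite -u1 (ord3_sum _ le e'e e'l) ue; ring.
Qed.

Lemma inA_le1 e u l : inA e u -> coord u l <= 1.
Proof.
move=> uA; have [_ ue u0] := inAP uA.
have [->|le] := eqVneq l e; first by rewrite ue.
have [k [ke kl _]] := ord3_third le.
by have := u0 k; rewrite (inA_compl uA le ke kl) subr_ge0.
Qed.

Lemma inA_eq e u v l : inA e u -> inA e v -> l != e ->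
  coord u l = coord v l -> u = v.
Proof.
move=> uA vA le uv; have [k [ke kl all_k]] := ord3_third le.
apply/rowP=> i; rewrite -![_ ord0 i]/(coord _ i).
have [_ ue _] := inAP uA; have [_ ve _] := inAP vA.
case: (all_k i) => ->; rewrite ?ue ?ve //.
by rewrite (inA_compl uA le ke kl) (inA_compl vA le ke kl) uv.
Qed.

(** The relative interior of an edge. Vertices lie on two edges, whereas a point here determines its
    edge. *)
Definition inside e u := inA e u /\ forall l, l != e -> 0 < coord u l.

Lemma inside_inA e e' u : inside e u -> inA e' u -> e' = e.
Proof.
move=> [_ u0] /inAP[_ ue' _]; apply/eqP/negPn/negP => /u0.
by rewrite ue' ltxx.
Qed.

Lemma gam_gt0 l : 0 < mu l - lam l.
Proof. by have := rho_lt1 l; rewrite ltr_pdivrMr // mul1r subr_gt0. Qed.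

Lemma f_self l u : coord (f lam mu l u) l = 0.
Proof. by rewrite /coord mxE eqxx. Qed.

(** [mu l * theta l] is the total arrival rate minus [mu l], so the denominator interpolates
    linearly between [mu l - lam l] and [lam e + lam e']. *)
Lemma f_den l e e' t : e != l -> e' != l -> e' != e ->
  mu l - lam l + mu l * theta lam mu l * t =
  (mu l - lam l) * (1 - t) + (lam e + lam e') * t.
Proof.
move=> el e'l e'e; rewrite /theta (ord3_sum _ el e'l e'e).
by rewrite mulrBr mulr1 mulrA divff ?gt_eqF //; ring.
Qed.

Lemma f_coord e e' l u : inA e u -> e != l -> e' != l -> e' != e ->
  coord (f lam mu l u) e = pushed (lam e) (lam e') (mu l - lam l) (coord u l).
Proof.
move=> /inAP[_ ue _] el e'l e'e.
rewrite {1}/coord mxE (negPf el) (f_den _ el e'l e'e) ue /pushed; congr (_ / _); ring.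
Qed.

Lemma f_inside e l u : inA e u -> l != e -> 0 < coord u l ->
  inside l (f lam mu l u).
Proof.
move=> uA le ul; have ul1 := inA_le1 l uA.
have el : e != l by rewrite eq_sym.
have [k [kl ke all_k]] := ord3_third el.
have den := pushed_den_gt0 (lam_gt0 e) (lam_gt0 k) (gam_gt0 l) ul ul1.
have fe0 : 0 < coord (f lam mu l u) e.
  by rewrite (f_coord uA el kl ke) divr_gt0 // mulr_gt0.
have fkE : coord (f lam mu l u) k = ((mu l - lam l) * (1 - coord u l) + lam k * coord u l) /
    ((mu l - lam l) * (1 - coord u l) + (lam e + lam k) * coord u l).
  rewrite {1}/coord mxE (negPf kl) (f_den _ el kl ke).
  by rewrite (inA_compl uA le ke kl).
have fk0 : 0 < coord (f lam mu l u) k.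
  rewrite fkE divr_gt0 // ltr_wpDl ?mulr_gt0 // mulr_ge0 ?subr_ge0 // ltW //.
  by rewrite -subr_gt0 gam_gt0.
have pos x : x != l -> 0 < coord (f lam mu l u) x.
  by case: (all_k x) => ->; rewrite ?eqxx.
split=> //; apply/and3P; split; last 1 first.
- by apply/forallP=> x; have [->|/pos/ltW//] := eqVneq x l; rewrite f_self.
- apply/eqP; rewrite (ord3_sum _ el kl ke) f_self fkE (f_coord uA el kl ke) /pushed.
  by field; rewrite gt_eqF.
- by rewrite f_self.
Qed.

(** Because [0 < d e < 1], the rule never selects an index whose coordinate vanishes, not even at a
    vertex. *)
Lemma step_target u v : step lam mu d u v -> exists e b,
  [/\ inA e u, v = f lam mu (target e b) u, 0 < coord u (target e b) &
   if b then coord u (ordS (ordS e)) <= d e else d e <= coord u (ordS (ordS e))].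
Proof.
case/existsP=> e /andP[uA /orP[]/andP[ud /eqP->]]; exists e.
  exists true; split=> //=.
  have := inA_compl uA (target_neq e false) (target_neq e true).
  move=> /= ->; last by case: e {uA ud} => -[|[|[|]]].
  by rewrite subr_gt0 (le_lt_trans ud) //; case/andP: (d01 e).
by exists false; split=> //=; rewrite (lt_le_trans _ ud) //; case/andP: (d01 e).
Qed.

Lemma step_inside u v : step lam mu d u v -> exists e, inside e v.
Proof.
case/step_target=> e [b [uA -> u0 _]]; exists (target e b).
exact: f_inside uA (target_neq e b) u0.
Qed.

(** [w] is inside a single edge, which fixes the index [l] of the map applied. Preimages on one edge
    agree by [pushed_inj]; on two different edges, [pushed_sum] forces both to be the vertex
    [e_l]. *)
Lemma step_inj u v w : step lam mu d u w -> step lam mu d v w -> u = v.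
Proof.
move=> /step_target[e [b [uA wu u0 _]]] /step_target[e1 [b1 [vA wv v0 _]]].
have le := target_neq e b; have le1 := target_neq e1 b1.
set l := target e b in wu u0 le; set l1 := target e1 b1 in wv v0 le1.
have wl : inside l w by rewrite wu; apply: f_inside uA le u0.
have /inside_inA/(_ _)/= : inside l1 w by rewrite wv; apply: f_inside vA le1 v0.
move=> /(_ l wl.1) ell1; rewrite -ell1 in wv v0 le1.
have u1 := inA_le1 l uA; have v1 := inA_le1 l vA.
have el : e != l by rewrite eq_sym.
have e1l : e1 != l by rewrite eq_sym.
have u01 : 0 < coord u l <= 1 by rewrite u0.
have v01 : 0 < coord v l <= 1 by rewrite v0.
have [ee|ee] := eqVneq e1 e.
  rewrite {}ee {e1l e1 le1 b1 l1 ell1} in vA *.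
  have [k [kl ke _]] := ord3_third el.
  apply: (inA_eq uA vA le); apply: (pushed_inj (lam_gt0 e) (lam_gt0 k) (gam_gt0 l)) => //.
  by rewrite -(f_coord uA el kl ke) -(f_coord vA el kl ke) -wu -wv.
have ee' : e != e1 by rewrite eq_sym.
have := inA_compl wl.1 el e1l ee.
rewrite {1}wv {1}wu (f_coord uA el e1l ee) (f_coord vA e1l el ee') => puv.
have [|ul vl] := pushed_sum (lam_gt0 e) (lam_gt0 e1) (gam_gt0 l) u01 v01; first by rewrite puv; ring.
have [k [kl ke all_k]] := ord3_third el.
have [_ ue _] := inAP uA; have [_ ve _] := inAP vA.
have e1k : e1 = k by case: (all_k e1) ee e1l => ->; rewrite ?eqxx.
apply/rowP=> i; rewrite -![_ ord0 i]/(coord _ i).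
case: (all_k i) => ->.
- by rewrite ul vl.
- by rewrite ue (inA_compl vA le1 ee' el) vl subrr.
- by rewrite -e1k ve (inA_compl uA le ee e1l) ul subrr.
Qed.

(** At the decision point both branches are allowed, so the branch is read off from [v]; the test is
    unambiguous because the two candidate images lie inside different edges. *)
Lemma inside_step e u v : inside e u -> step lam mu d u v ->
  let b := v == f lam mu (ordS e) u in
  v = f lam mu (target e b) u /\
  if b then coord u (ordS (ordS e)) <= d e else d e <= coord u (ordS (ordS e)).
Proof.
move=> ue /step_target[e0 [b [uA vE u0 ud]]] /=.
have e0E := inside_inA ue uA; rewrite {}e0E {e0} in uA vE u0 ud.
case: eqVneq => [v1|v1]; last by case: b vE ud u0 => vE ud u0 //; rewrite vE eqxx in v1.
case: b vE ud u0 => // vE _ u0.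
have [] := f_inside uA (target_neq e false) u0; rewrite -vE v1 => _ /(_ (ordS e)).
by rewrite f_self ltxx eq_sym (target_neq (ordS e) true) => /(_ isT).
Qed.

(** Reconciles the cyclic coordinate used for positions with the one in which [pushed] expresses the
    map. *)
Lemma hdist_coord e u v l l' : inA e u -> inA e v -> l != e -> l' != e ->
  hdist (coord u l) (coord v l) = hdist (coord u l') (coord v l').
Proof.
move=> uA vA le l'e; have [->//|ll] := eqVneq l l'.
by rewrite (inA_compl uA l'e le ll) (inA_compl vA l'e le ll) hdist_compl.
Qed.

Lemma inside_lt1 e u l : inside e u -> coord u l < 1.
Proof.
move=> [uA u0]; have [->|le] := eqVneq l e.
  by have [_ -> _] := inAP uA; rewrite ltr01.
have [k [ke kl _]] := ord3_third le.
by have := u0 k ke; rewrite (inA_compl uA le ke kl) subr_gt0.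
Qed.

Lemma hdist_f e l u v p q : inside e u -> inside e v -> u != v ->
  l != e -> p != e -> q != l ->
  hdist (coord (f lam mu l u) q) (coord (f lam mu l v) q) <
  hdist (coord u p) (coord v p).
Proof.
move=> ui vi uv le pe ql; have [uA u0] := ui; have [vA v0] := vi.
have el : e != l by rewrite eq_sym.
have [k [kl ke _]] := ord3_third el.
have [fu _] := f_inside uA le (u0 l le); have [fv _] := f_inside vA le (v0 l le).
rewrite (hdist_coord fu fv ql el) (hdist_coord uA vA pe le).
rewrite (f_coord uA el kl ke) (f_coord vA el kl ke).
apply: hdist_pushed => //; rewrite ?gam_gt0 ?u0 ?v0 ?(inside_lt1 _ ui) ?(inside_lt1 _ vi) //.
by apply: contra_neq uv; apply: inA_eq uA vA le.
Qed.

Lemma orbit_inside s u : periodic_orbit lam mu d s -> u \in s -> exists e, inside e u.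
Proof.
case/and4P=> _ us _ cs us_.
by apply: (@step_inside (prev s u)); apply: prev_cycle.
Qed.

Lemma orbits_meet s t u : periodic_orbit lam mu d s -> periodic_orbit lam mu d t ->
  u \in s -> u \in t -> exists n, s = rot n t.
Proof.
move=> /and4P[_ us _ cs] /and4P[_ ut _ ct].
exact: cycles_meet_rot step_inj us ut cs ct.
Qed.

(** * Counting pairwise disjoint orbits *)

Section Disjoint.
Variable O : seq (seq 'rV[R]_3).
Hypothesis O_orbit : {in O, forall s, periodic_orbit lam mu d s}.
Hypothesis O_uniq : uniq O.
Hypothesis O_disj : {in O &, forall s t u, u \in s -> u \in t -> s = t}.

Let P := flatten O.
(** The label of a point is the orbit containing it; by [O_disj] it is unique, and the default is
    not reached on [P]. *)
Let orb u := nth [::] O (find (fun s => u \in s) O).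
Let nxt u := next (orb u) u.
Let edge u := odflt ord0 [pick i | coord u i == 0].
(** Defined by the successor in the orbit, since position alone does not decide the side at the
    decision point. *)
Let side u := nxt u == f lam mu (ordS (edge u)) u.
Let pos u := coord u (ordS (ordS (edge u))).

Let orbP u : u \in P -> orb u \in O /\ u \in orb u.
Proof.
move=> /flattenP uP; have hO : has (fun s => u \in s) O by apply/hasP; case: uP => s; exists s.
by split; [apply: mem_nth; rewrite -has_find | apply: (nth_find [::] hO)].
Qed.

Let orbE s u : s \in O -> u \in s -> orb u = s.
Proof.
move=> sO us; have [|oO uo] := @orbP u; first by apply/flattenP; exists s.
exact: O_disj uo us.
Qed.

Let nxtP u : u \in P -> [/\ nxt u \in P, orb (nxt u) = orb u & step lam mu d u (nxt u)].
Proof.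
move=> /orbP[oO uo]; have no : nxt u \in orb u by rewrite mem_next.
split; [by apply/flattenP; exists (orb u) | exact: orbE |].
by have /and4P[_ _ _ cs] := O_orbit oO; apply: next_cycle.
Qed.

Let edgeE e u : inside e u -> edge u = e.
Proof.
move=> [uA u0]; rewrite /edge; case: pickP => [i|/(_ e)] /=.
  by apply: contraTeq => /u0 /gt_eqF ->.
by have [_ -> _] := inAP uA; rewrite eqxx.
Qed.

Let P_inside u : u \in P -> inside (edge u) u.
Proof.
by move=> /orbP[oO uo]; have [e ue] := orbit_inside (O_orbit oO) uo; rewrite (edgeE ue).
Qed.

Let nxtE u : u \in P -> nxt u = f lam mu (target (edge u) (side u)) u /\
  if side u then pos u <= d (edge u) else d (edge u) <= pos u.
Proof. by move=> uP; have [_ _] := nxtP uP; apply: inside_step; apply: P_inside. Qed.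

Let pos01 u : u \in P -> 0 < pos u < 1.
Proof.
move=> /P_inside ui; rewrite (inside_lt1 _ ui) andbT; case: ui => _; apply.
exact: (target_neq _ false).
Qed.

Let edge_nxt u : u \in P -> edge (nxt u) = target (edge u) (side u).
Proof.
move=> uP; have [-> _] := nxtE uP; apply: edgeE.
have [uA u0] := P_inside uP; apply: f_inside uA (target_neq _ _) _.
exact/u0/target_neq.
Qed.

(** Supplies the points next to the decision points: [F] is [- pos] on the lower side and [pos] on
    the upper side. *)
Let extremal (F : 'rV[R]_3 -> R) (b : bool) : exists top : 'I_3 -> 'rV[R]_3,
  {in P, forall u, side u = b -> let t := top (edge u) in
    [/\ t \in P, edge t = edge u, side t = b & F t <= F u]}.
Proof.
have /fin_all_exists[top topP] (i : 'I_3) : exists t, {in P, forall u, edge u = i ->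
    side u = b -> [/\ t \in P, edge t = i, side t = b & F t <= F u]}.
  pose s := [seq u <- P | (edge u == i) && (side u == b)].
  have sP u : (u \in s) = [&& edge u == i, side u == b & u \in P] by rewrite mem_filter andbA.
  have [s0|s0] := boolP (s == [::]).
    (* No point of [P] lies on this side, so any value serves. *)
    exists 0 => u uP ue ub; have : u \in s by rewrite sP ue ub !eqxx.
    by rewrite (eqP s0).
  have [x0 xs] : exists x, x \in s by case: (s) s0 => // x ? _; exists x; rewrite mem_head.
  have [t] := seq_argmin F xs; rewrite sP => /and3P[/eqP te /eqP tb tP] tmin.
  by exists t => u uP ue ub; split=> //; apply: tmin; rewrite sP ue ub !eqxx.
by exists top => u uP ub; apply: topP.
Qed.

Lemma disjoint_orbits_size : (size O <= 4)%N.
Proof.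
rewrite leqNgt; apply/negP => O4.
have [top topP] := extremal (fun u => - pos u) true.
have [bot botP] := extremal pos false.
(* The i-th merge identifies the orbits of [top i] and [bot i]; [g] still separates two orbits [s]
   and [t], against the constancy of [g \o orb]. *)
have [g [g_tb [s sO [t tO]]]] := merge_three (orb \o top) (orb \o bot) O_uniq O4.
have nonempty r : r \in O -> exists2 u, u \in P & orb u = r.
  move=> rO; have /and4P[] := O_orbit rO; case: r rO => // u r rO _ _ _ _.
  exists u; last by apply: orbE; rewrite ?mem_head.
  by apply/flattenP; exists (u :: r); rewrite ?mem_head.
have [u uP <-] := nonempty s sO; have [v vP <-] := nonempty t tO => /eqP; apply.
apply: (@invariant_const _ _ P edge side pos (fun u v => hdist (pos u) (pos v)) nxt
  _ _ _ _ _ _ _ _ (g \o orb) top bot) => //.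
- by move=> w /nxtP[].
- move=> w wP; have [oO wo] := orbP wP; have /and4P[_ uo _ _] := O_orbit oO.
  have po : prev (orb w) w \in orb w by rewrite mem_prev.
  exists (prev (orb w) w); first by apply/flattenP; exists (orb w).
  by rewrite /nxt (orbE oO po) next_prev.
- by move=> a b; apply: hdistC.
- move=> a b aP bP ab eab sab; rewrite /pos !edge_nxt // -eab -sab.
  have [-> _] := nxtE aP; have [-> _] := nxtE bP; rewrite -eab -sab.
  apply: (hdist_f (e := edge a)); rewrite ?target_neq //; try exact: P_inside.
  + by rewrite {1}eab; apply: P_inside.
  + exact: (target_neq _ false).
  + exact: (target_neq _ false).
- move=> a b aP bP eab sa sb; have [_] := nxtE aP; have [_] := nxtE bP.
  by rewrite sa (negPf sb) eab => db da; apply: le_trans da db.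
- move=> a c b aP cP bP _ _ acb.
  have /andP[a0 _] := pos01 aP; have /andP[_ b1] := pos01 bP.
  by split; [apply: hdist_monor | apply: hdist_monol].
- by move=> w /nxtP[_ /= ->].
- by move=> w wP sw; have [? ? ?] := topP w wP sw; rewrite lerN2.
- by move=> w wP /negPf sw; have [? ? /negbT ? ?] := botP w wP sw.
Qed.
End Disjoint.
End Process.

Theorem theorem3p2 (R : realType) (lam mu : 'I_3 -> R) (d : 'I_3 -> R) :
  (forall i, 0 < lam i) -> (forall i, 0 < mu i) ->
  (forall i, lam i / mu i < 1) ->
  1 < \sum_(i < 3) lam i / mu i ->
  (forall i, 0 < d i < 1) ->
  exists O : seq (seq 'rV[R]_3),
    (size O <= 4)%N /\
    forall s, periodic_orbit lam mu d s ->
      exists2 t, t \in O & exists n : nat, s = rot n t.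
Proof.
move=> lam_gt0 mu_gt0 rho_lt1 _ d01; apply: contrapT => no_cover.
(* Greedy choice: at most four orbits never cover everything, so another one can be added, and
   [orbits_meet] makes it disjoint from the earlier ones. Reaching five contradicts
   [disjoint_orbits_size]. *)
have many n : (n <= 5)%N -> exists O : seq (seq 'rV[R]_3), [/\ size O = n, uniq O,
    {in O, forall s, periodic_orbit lam mu d s} &
    {in O &, forall s t u, u \in s -> u \in t -> s = t}].
  elim: n => [|n IHn] n5; first by exists [::].
  have [O [On O_uniq O_orbit O_disj]] := IHn (ltnW n5).
  have [s s_orbit sO] : exists2 s, periodic_orbit lam mu d s &
      forall t, t \in O -> forall k, s <> rot k t.
    apply: contrapT => none; apply: no_cover; exists O; split; first by rewrite On.
    move=> s s_orbit; apply: contrapT => s_far; apply: none; exists s => // t tO k sE.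
    by apply: s_far; exists t => //; exists k.
  have sO_disj t u : t \in O -> u \in s -> u \in t -> False.
    move=> tO us ut; have [k] := orbits_meet lam_gt0 mu_gt0 rho_lt1 d01 s_orbit (O_orbit t tO) us ut.
    exact: sO.
  exists (s :: O); split=> /=.
  - by rewrite On.
  - by rewrite O_uniq andbT; apply/negP => /sO/(_ 0%N); rewrite rot0.
  - by move=> t; rewrite inE => /predU1P[->|/O_orbit].
  - move=> t r; rewrite !inE => /predU1P[->|tO] /predU1P[->|rO] u // ut ur.
    + by case: (sO_disj r u).
    + by case: (sO_disj t u).
    + exact: O_disj ut ur.
have [O [O5 O_uniq O_orbit O_disj]] := many 5 isT.
by have := disjoint_orbits_size lam_gt0 mu_gt0 rho_lt1 d01 O_orbit O_uniq O_disj; rewrite O5.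
Qed.
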